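(* Let $\lambda$ be a nonzero real number, let $(a_{n,\lambda})_{n\ge 0}$ be a sequence of real numbers, and let $(a_{n,k}(\lambda))_{n,k\ge 0}$ be its degenerate Euler-Seidel matrix. Then for every integer $n\ge 0$, $$a_{0,n}(\lambda)=\sum_{k=0}^{n}\binom{n}{k}(1-\lambda)_{n-k,\lambda}\,a_{k,0}(\lambda).$$
   Context: For a nonzero real number $\lambda$ and real $x$, the generalized falling factorials are $(x)_{0,\lambda}=1$ and $(x)_{n,\lambda}=x(x-\lambda)\cdots(x-(n-1)\lambda)$ for $n\ge 1$. Given a sequence $(a_{n,\lambda})_{n\ge 0}$, its degenerate Euler-Seidel matrix $(a_{n,k}(\lambda))_{n,k\ge 0}$ is defined recursively by $a_{n,0}(\lambda)=a_{n,\lambda}$ for $n\ge 0$, and $a_{n,k}(\lambda)=\big(1-(k-n)\lambda\big)a_{n,k-1}(\lambda)+a_{n+1,k-1}(\lambda)$ for $n\ge 0$, $k\ge 1$. *)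

(* Defs.v *)
From mathcomp Require Import all_boot all_order all_algebra.
From mathcomp Require Import reals.

Set Implicit Arguments.
Unset Strict Implicit.
Unset Printing Implicit Defensive.

Import Order.TTheory GRing.Theory Num.Theory.
Local Open Scope ring_scope.

Definition gen_ffact (R : realType) (lambda x : R) (n : nat) : R :=
  \prod_(i < n) (x - i%:R * lambda).

(* Recursion on the second index; [k - n] may be negative, so the difference
   is taken in [R]. *)
Fixpoint euler_seidel (R : realType) (lambda : R) (a : nat -> R) (n k : nat)
    {struct k} : R :=
  if k is k'.+1 then
    (1 - (k%:R - n%:R) * lambda) * euler_seidel lambda a n k'
    + euler_seidel lambda a n.+1 k'
  else a n.

(* Main.v *)
Require Import Defs.
From mathcomp Require Import all_boot all_order all_algebra.
From mathcomp Require Import reals.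
From mathcomp Require Import ring.

Set Implicit Arguments.
Unset Strict Implicit.
Unset Printing Implicit Defensive.

Import Order.TTheory GRing.Theory Num.Theory.
Local Open Scope ring_scope.

(** The formula for row 0 of the Euler-Seidel matrix cannot be proved by
    induction on its own, because the recursion for row [n] calls row [n + 1].
    It is the case [n = 0] of a formula for every row, [euler_seidelE]:
    [a_(n,k) = \sum_(j <= k) 'C(k, j) (x)_(k-j) a_(n+j)] with
    [x = 1 + (n - 1) lambda], which is proved by induction on [k] for all [n]
    at once.  Passing to row [n + 1] replaces [x] by [x + lambda], and the
    factor [1 - (k + 1 - n) lambda] of the recursion is [x - k lambda], so
    comparing coefficients leaves a Pascal rule for the numbers
    ['C(k, j) (x)_(k-j)], [bin_gen_ffactS].  That rule holds because
    [(x)_(m+1) = (x)_m (x - m lambda)] and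
    [(x + lambda)_(m+1) = (x + lambda) (x)_m] reduce it to the absorption
    identity [(i + 1) 'C(k, i + 1) = (k - i) 'C(k, i)]. *)

Lemma gen_ffact0 (R : realType) (lambda x : R) : gen_ffact lambda x 0 = 1.
Proof. by rewrite /gen_ffact big_ord0. Qed.

Lemma gen_ffactSr (R : realType) (lambda x : R) (n : nat) :
  gen_ffact lambda x n.+1 = gen_ffact lambda x n * (x - n%:R * lambda).
Proof. by rewrite /gen_ffact big_ord_recr. Qed.

Lemma gen_ffact_shiftS (R : realType) (lambda x : R) (n : nat) :
  gen_ffact lambda (x + lambda) n.+1 = (x + lambda) * gen_ffact lambda x n.
Proof.
rewrite /gen_ffact big_ord_recl mul0r subr0; congr (_ * _).
apply: eq_bigr => i _; rewrite lift0 -natr1; ring.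
Qed.

Lemma bin_gen_ffactS (R : realType) (lambda x : R) (k i : nat) :
  (i <= k)%N ->
  'C(k.+1, i.+1)%:R * gen_ffact lambda x (k - i) =
    (x - k%:R * lambda) * ('C(k, i.+1)%:R * gen_ffact lambda x (k - i.+1))
    + 'C(k, i)%:R * gen_ffact lambda (x + lambda) (k - i).
Proof.
rewrite leq_eqVlt => /predU1P[->|lt_ik].
  by rewrite subnn !gen_ffact0 !binn bin_small // mul0r mulr0 add0r.
set m := (k - i.+1)%N.
have k_i : (k - i = m.+1)%N by rewrite /m subnSK.
have kE : k%:R = i%:R + m%:R + 1 :> R.
  by rewrite -natrD natr1 /m -addnS subnSK // subnKC // ltnW.
have absorb : i.+1%:R * 'C(k, i.+1)%:R = m.+1%:R * 'C(k, i)%:R :> R.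
  by rewrite -!natrM mul_bin_left k_i.
rewrite k_i gen_ffact_shiftS gen_ffactSr binS natrD kE.
rewrite -!natr1 in absorb.
set F := gen_ffact _ _ _; set b := 'C(k, i.+1)%:R in absorb *.
set c := 'C(k, i)%:R in absorb *.
apply/eqP; rewrite -subr_eq0; apply/eqP.
transitivity (F * lambda * ((i%:R + 1) * b - (m%:R + 1) * c)); first by ring.
by rewrite absorb subrr mulr0.
Qed.

(** Closed form of every entry in terms of the first column. *)
Lemma euler_seidelE (R : realType) (lambda : R) (a : nat -> R) (n k : nat) :
  euler_seidel lambda a n k =
    \sum_(j < k.+1) 'C(k, j)%:R
      * gen_ffact lambda (1 - lambda + n%:R * lambda) (k - j) * a (n + j)%N.
Proof.
elim: k n => [|k IHk] n.
  by rewrite big_ord1 gen_ffact0 bin0 !mul1r addn0.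
rewrite [LHS]/= !IHk; set x := 1 - lambda + n%:R * lambda.
have -> : 1 - lambda + n.+1%:R * lambda = x + lambda by rewrite -natr1 /x; ring.
have -> : 1 - (k.+1%:R - n%:R) * lambda = x - k%:R * lambda.
  by rewrite -natr1 /x; ring.
(* Adding the vanishing term [j = k + 1] to the row-[n] sum and splitting off
   [j = 0] aligns both sums with the indices [i + 1] of the right-hand side. *)
have -> : \sum_(j < k.+1) 'C(k, j)%:R * gen_ffact lambda x (k - j) * a (n + j)%N
        = \sum_(j < k.+2) 'C(k, j)%:R * gen_ffact lambda x (k - j) * a (n + j)%N.
  by rewrite [RHS]big_ord_recr /= bin_small // !mul0r addr0.
rewrite big_ord_recl [RHS]big_ord_recl /= !bin0 !subn0 gen_ffactSr.
rewrite mulrDr -addrA mulr_sumr -big_split /=; congr (_ + _); first by ring.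
apply: eq_bigr => i _; rewrite /bump leq0n add1n subSS addSnnS.
rewrite bin_gen_ffactS; last by rewrite -ltnS.
by rewrite [RHS]mulrDl !mulrA.
Qed.

Theorem theorem2p2 (R : realType) (lambda : R) (hlambda : lambda != 0)
    (a : nat -> R) (n : nat) :
  euler_seidel lambda a 0 n =
    \sum_(0 <= k < n.+1)
      'C(n, k)%:R * gen_ffact lambda (1 - lambda) (n - k)
      * euler_seidel lambda a k 0.
Proof. by rewrite euler_seidelE mul0r addr0 big_mkord. Qed.
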